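(* Let $\kappa$ be an infinite cardinal. Then there exist an ultrafilter $U$ over $\kappa$ and a sequence $\overline f=\langle f_\alpha:\alpha<\kappa^+\rangle$ of functions $f_\alpha:\kappa\to\mathrm{On}$ which is $<_I$-increasing, where $I=\{X\subseteq\kappa:\kappa\setminus X\in U\}$ is the dual ideal of $U$, such that all three of the following conditions fail for $\overline f$ and $I$: (1) $\overline f$ has an exact upper bound $f$ modulo $I$ with $\operatorname{cf} f(i)>\kappa$ for all $i<\kappa$; (2) there are sets $S(i)$, $i<\kappa$, with $|S(i)|\le\kappa$, and an ultrafilter $W$ over $\kappa$ extending the dual filter of $I$, such that for every $\alpha<\kappa^+$ there exist $h_\alpha\in\prod_{i<\kappa}S(i)$ and $\beta<\kappa^+$ with $f_\alpha<_W h_\alpha<_W f_\beta$; (3) there is a function $g:\kappa\to\mathrm{On}$ such that the sequence $\langle t_\alpha:\alpha<\kappa^+\rangle$, where $t_\alpha=\{i<\kappa: f_\alpha(i)>g(i)\}$, does not stabilize modulo $I$.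
   Context: $\mathrm{On}^\kappa$ denotes the class of functions from $\kappa$ to the ordinals. For an ideal $I$ over $\kappa$ and $f,g\in\mathrm{On}^\kappa$: $f<_I g$ means $\{i<\kappa: f(i)\ge g(i)\}\in I$, and $f\le_I g$ means $\{i<\kappa: f(i)>g(i)\}\in I$; for a filter $F$ (e.g. an ultrafilter), $<_F$ and $\le_F$ mean $<_I$ and $\le_I$ for the dual ideal $I=\{X:\kappa\setminus X\in F\}$. A sequence $\langle f_\alpha:\alpha<\lambda\rangle$ is $<_I$-increasing if $\alpha<\beta<\lambda$ implies $f_\alpha<_I f_\beta$. A function $f\in\mathrm{On}^\kappa$ is an exact upper bound of $\langle f_\alpha:\alpha<\lambda\rangle$ modulo $I$ if $f_\alpha\le_I f$ for all $\alpha<\lambda$ and whenever $g\in\mathrm{On}^\kappa$ satisfies $g<_I f$ there is $\alpha<\lambda$ with $g<_I f_\alpha$. For $t,s\subseteq\kappa$, $t\subseteq_I s$ means $t\setminus s\in I$, and $t=_I s$ means $t\subseteq_I s$ and $s\subseteq_I t$. A sequence of sets $\langle t_\alpha:\alpha<\lambda\rangle$ stabilizes modulo $I$ if there is $\alpha_0<\lambda$ such that $t_\alpha=_I t_{\alpha_0}$ for all $\alpha\ge\alpha_0$. *)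

(* Defs.v *)
From HB Require Import structures.
From mathcomp Require Import all_boot all_order.
From mathcomp Require Import boolp classical_sets functions cardinality filter.
From mathcomp Require wochoice.

Set Implicit Arguments.
Unset Strict Implicit.
Unset Printing Implicit Defensive.

Import Order.TTheory.

Local Open Scope classical_set_scope.
Local Open Scope order_scope.
Local Open Scope card_scope.
Local Open Scope quotient_scope.

(* Ordinals are isomorphism classes of well-orders on types of a fixed universe,
   compared by embedding onto an initial segment. The quotient On lives in a
   larger universe: like a proper class, it is not the order type of an ordinal. *)
Record wellOrder := WellOrder {
  wo_sort :> Type;
  wo_le : rel wo_sort;
  wo_leP : wochoice.well_order wo_le
}.

Section WellOrderTheory.
Variable A : wellOrder.
Implicit Types x y z : A.

Lemma wo_min (P : set A) : P !=set0 ->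
  exists2 x, P x & forall y, P y -> wo_le x y.
Proof.
move=> [a Pa]; have [|x [[Px lbx] _]] := @wo_leP A (fun x => `[< P x >]).
  by exists a; exact/asboolP.
exists x; first exact/asboolP.
by move=> y Py; apply: lbx; exact/asboolP.
Qed.

Lemma wo_total x y : wo_le x y || wo_le y x.
Proof.
have [|z [->|->] h] := @wo_min [set z | z = x \/ z = y]; first by exists x; left.
- by rewrite h //; right.
- by apply/orP; right; apply: h; left.
Qed.

Lemma wo_refl x : wo_le x x.
Proof. by have := wo_total x x; rewrite orbb. Qed.

Lemma wo_anti x y : wo_le x y -> wo_le y x -> x = y.
Proof.
move=> xy yx.
have [|z [_ uz]] := @wo_leP A (fun z => `[< z = x \/ z = y >]).
  by exists x; apply/asboolP; left.
rewrite -(uz x) ?(uz y) //; split; try by apply/asboolP; auto.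
  by move=> t /asboolP[]->//; exact: wo_refl.
by move=> t /asboolP[]->//; exact: wo_refl.
Qed.

Lemma wo_trans x y z : wo_le x y -> wo_le y z -> wo_le x z.
Proof.
move=> xy yz.
have [|t [->|[->|->]] h] :=
  @wo_min [set t | t = x \/ t = y \/ t = z]; first by exists x; left.
- by apply: h; right; right.
- have yx : wo_le y x by apply: h; left.
  by rewrite (wo_anti xy yx).
- have zy : wo_le z y by apply: h; right; left.
  by rewrite -(wo_anti yz zy).
Qed.

Lemma wo_ind (P : A -> Prop) :
  (forall x, (forall y, ~~ wo_le x y -> P y) -> P x) -> forall x, P x.
Proof.
move=> IH x; apply: contrapT => nPx.
have [|z nPz h] := @wo_min [set x | ~ P x]; first by exists x.
by apply: nPz; apply: IH => y zy; apply: contrapT => /h; exact/negP.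
Qed.

Lemma wo_ltW x y : ~~ wo_le x y -> wo_le y x.
Proof. by have := wo_total x y; case: wo_le. Qed.

End WellOrderTheory.

Definition initial_embedding (A B : wellOrder) (f : A -> B) :=
  {mono f : x y / wo_le x y} /\
  forall x b, wo_le b (f x) -> exists y, f y = b.

Definition wo_emb (A B : wellOrder) := exists f : A -> B, initial_embedding f.

Definition wo_iso (A B : wellOrder) :=
  exists2 f : A -> B, bijective f & {mono f : x y / wo_le x y}.

Lemma wo_iso_refl A : wo_iso A A.
Proof. by exists id => //; exact: (@Bijective _ _ _ id). Qed.

Lemma wo_iso_sym A B : wo_iso A B -> wo_iso B A.
Proof.
move=> [f [g fK gK] mf]; exists g; first exact: (@Bijective _ _ _ f).
by move=> x y; rewrite -mf !gK.
Qed.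

Lemma wo_iso_trans A B C : wo_iso A B -> wo_iso B C -> wo_iso A C.
Proof.
move=> [f bf mf] [g bg mg]; exists (g \o f); first exact: bij_comp.
by move=> x y /=; rewrite mg mf.
Qed.

HB.instance Definition _ := gen_eqMixin wellOrder.
HB.instance Definition _ := gen_choiceMixin wellOrder.

Definition wo_isob (A B : wellOrder) := `[< wo_iso A B >].

Lemma wo_isob_equiv : equiv_class_of wo_isob.
Proof.
split=> [A|A B|B A C].
- exact/asboolP/wo_iso_refl.
- by apply/asboolP/asboolP; exact: wo_iso_sym.
- move=> /asboolP AB /asboolP BC; exact/asboolP/(wo_iso_trans AB).
Qed.

Canonical wo_iso_equiv := EquivRelPack wo_isob_equiv.

Definition On := {eq_quot wo_iso_equiv}.

HB.instance Definition _ := Choice.on On.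
HB.instance Definition _ := EqQuotient.on On.

Lemma On_eqP (A B : wellOrder) : wo_iso A B <-> \pi_On A = \pi_On B.
Proof.
by split=> [h|/eqP]; [apply/eqP|]; rewrite eqmodE; [exact/asboolP|move/asboolP].
Qed.

Definition On_le (a b : On) := `[< wo_emb (repr a) (repr b) >].

Lemma wo_emb_refl A : wo_emb A A.
Proof. by exists id; split=> // x b _; exists b. Qed.

Lemma wo_emb_trans A B C : wo_emb A B -> wo_emb B C -> wo_emb A C.
Proof.
move=> [f [mf jf]] [g [mg jg]]; exists (g \o f); split=> [x y|x c] /=.
  by rewrite mg mf.
move=> /[dup] h /jg[b bc]; move: h; rewrite -bc mg => /jf[y <-]; by exists y.
Qed.

Lemma wo_iso_emb A B : wo_iso A B -> wo_emb A B.
Proof. by move=> [f [g fK gK] mf]; exists f; split=> // x b _; exists (g b). Qed.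

Lemma initial_embedding_uniq (A B : wellOrder) (f g : A -> B) :
  initial_embedding f -> initial_embedding g -> f =1 g.
Proof.
move=> [mf jf] [mg jg]; elim/wo_ind => x IH.
apply: wo_anti; apply: contraT => h.
  have [y fyx] := jf x (g x) (wo_ltW h).
  have hy : ~~ wo_le x y by rewrite -mf fyx.
  by move: (hy); rewrite -mg -fyx (IH _ hy) wo_refl.
have [y gyx] := jg x (f x) (wo_ltW h).
have hy : ~~ wo_le x y by rewrite -mg gyx.
by move: (hy); rewrite -mf -gyx (IH _ hy) wo_refl.
Qed.

Lemma wo_emb_anti A B : wo_emb A B -> wo_emb B A -> wo_iso A B.
Proof.
move=> [f [mf jf]] [g [mg jg]].
have comp (C D : wellOrder) (u : C -> D) (v : D -> C) :
    initial_embedding u -> initial_embedding v -> cancel u v.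
  move=> [mu ju] [mv jv] x; apply: (@initial_embedding_uniq _ _ (v \o u) id);
    last by split=> // y c _; exists c.
  split=> [y z|y c] /=; first by rewrite mv mu.
  move=> /[dup] h /jv[b bc]; move: h; rewrite -bc mv => /ju[z <-].
  by exists z.
by exists f => //; exists g; exact: comp.
Qed.

Section Comparison.
Variables A B : wellOrder.

Inductive wo_match : A -> B -> Prop := WoMatch a b of
  (forall a', ~~ wo_le a a' -> exists2 b', ~~ wo_le b b' & wo_match a' b') &
  (forall b', ~~ wo_le b b' -> exists2 a', ~~ wo_le a a' & wo_match a' b') :
  wo_match a b.

Lemma wo_match_inv a b : wo_match a b ->
  (forall a', ~~ wo_le a a' -> exists2 b', ~~ wo_le b b' & wo_match a' b') /\
  (forall b', ~~ wo_le b b' -> exists2 a', ~~ wo_le a a' & wo_match a' b').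
Proof. by case. Qed.

Lemma wo_match_fun a b c : wo_match a b -> wo_match a c -> b = c.
Proof.
elim/wo_ind: a b c => a IH.
suff le b c : wo_match a b -> wo_match a c -> wo_le b c.
  by move=> b c ab ac; apply: wo_anti; exact: le.
move=> /wo_match_inv[_ ba] /wo_match_inv[ac _]; apply: contraT => bc.
have [a' aa' a'c] := ba c bc; have [c' cc' a'c'] := ac a' aa'.
by move: cc'; rewrite -(IH _ aa' _ _ a'c a'c') wo_refl.
Qed.

Lemma wo_match_inj a b c : wo_match a c -> wo_match b c -> a = b.
Proof.
elim/wo_ind: c a b => c IH.
suff le a b : wo_match a c -> wo_match b c -> wo_le a b.
  by move=> a b ac bc; apply: wo_anti; exact: le.
move=> /wo_match_inv[ac _] /wo_match_inv[_ cb]; apply: contraT => ab.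
have [c' cc' bc'] := ac b ab; have [b' bb' b'c'] := cb c' cc'.
by move: bb'; rewrite -(IH _ cc' _ _ bc' b'c') wo_refl.
Qed.

Lemma wo_match_mono a b a' b' : wo_match a b -> wo_match a' b' ->
  wo_le a a' = wo_le b b'.
Proof.
move=> ab a'b'; apply/idP/idP => h; apply: contraT => nh.
  have [a'' aa''] := (wo_match_inv ab).2 b' nh.
  by move=> /(wo_match_inj a'b') aE; move: aa''; rewrite -aE h.
have [b'' bb''] := (wo_match_inv ab).1 a' nh.
by move=> /(wo_match_fun a'b') bE; move: bb''; rewrite -bE h.
Qed.

Lemma wo_match_total :
  (forall a, exists b, wo_match a b) \/ (forall b, exists a, wo_match a b).
Proof.
apply: contrapT => /not_orP[/existsNP nA /existsNP nB].
have [a na mina] := @wo_min A [set a | ~ exists b, wo_match a b] nA.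
have [b nb minb] := @wo_min B [set b | ~ exists a, wo_match a b] nB.
apply: (na); exists b; constructor=> [a' aa'|b' bb'].
  have [b' a'b'] : exists b', wo_match a' b'.
    by apply: contrapT => /mina; exact/negP.
  exists b' => //; apply/negP => bb'; apply: nb.
  have [<-|ne] := pselect (b' = b); first by exists a'.
  have lt : ~~ wo_le b' b by apply/negP => b'b; apply: ne; exact: wo_anti.
  by have [a'' _ ?] := (wo_match_inv a'b').2 b lt; exists a''.
have [a' a'b'] : exists a', wo_match a' b'.
  by apply: contrapT => /minb; exact/negP.
exists a' => //; apply/negP => aa'; apply: na.
have [<-|ne] := pselect (a' = a); first by exists b'.
have lt : ~~ wo_le a' a by apply/negP => a'a; apply: ne; exact: wo_anti.
by have [b'' _ ?] := (wo_match_inv a'b').1 a lt; exists b''.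
Qed.

End Comparison.

Lemma wo_emb_total A B : wo_emb A B \/ wo_emb B A.
Proof.
have [/choice[f fP]|/choice[f fP]] := wo_match_total A B; [left|right].
  exists f; split=> [x y|x b].
    by rewrite (wo_match_mono (fP x) (fP y)).
  have [->|ne] := pselect (b = f x); first by exists x.
  move=> bx; have lt : ~~ wo_le (f x) b.
    by apply/negP => xb; apply: ne; exact: wo_anti.
  have [y _ yb] := (wo_match_inv (fP x)).2 b lt.
  by exists y; exact: wo_match_fun (fP y) yb.
exists f; split=> [x y|x b].
  by rewrite (wo_match_mono (fP x) (fP y)).
have [->|ne] := pselect (b = f x); first by exists x.
move=> bx; have lt : ~~ wo_le (f x) b.
  by apply/negP => xb; apply: ne; exact: wo_anti.
have [y _ yb] := (wo_match_inv (fP x)).1 b lt.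
by exists y; exact: wo_match_inj (fP y) yb.
Qed.

Lemma On_lePi A B : On_le (\pi_On A) (\pi_On B) <-> wo_emb A B.
Proof.
have e C : wo_iso (repr (\pi_On C)) C by apply/On_eqP; rewrite reprK.
split=> [/asboolP h|h]; [|apply/asboolP].
  apply: wo_emb_trans (wo_iso_emb (e B)); apply: wo_emb_trans h.
  exact/wo_iso_emb/wo_iso_sym.
apply: wo_emb_trans (wo_iso_emb (e A)) _; apply: wo_emb_trans h _.
exact/wo_iso_emb/wo_iso_sym.
Qed.

Lemma On_le_anti : antisymmetric On_le.
Proof.
move=> a b /andP[]; rewrite -[a]reprK -[b]reprK => /On_lePi ab /On_lePi ba.
exact/On_eqP/wo_emb_anti.
Qed.

Lemma On_le_trans : transitive On_le.
Proof.
move=> b a c; rewrite -[a]reprK -[b]reprK -[c]reprK.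
by move=> /On_lePi ab /On_lePi bc; apply/On_lePi; exact: wo_emb_trans ab bc.
Qed.

Lemma On_le_total : total On_le.
Proof.
move=> a b; rewrite -[a]reprK -[b]reprK.
by apply/orP; have [|] := wo_emb_total (repr a) (repr b); [left|right];
  apply/On_lePi.
Qed.

Fact On_display : Order.disp_t. Proof. exact: Order.Disp tt tt. Qed.

HB.instance Definition _ := @Order.isOrder.Build On_display On
  On_le (fun a b => (b != a) && On_le a b) _ _
  (fun _ _ => erefl) (fun _ _ => erefl) (fun _ _ => erefl)
  On_le_anti On_le_trans On_le_total.

Lemma On_leP A B : (\pi_On A <= \pi_On B) <-> wo_emb A B.
Proof. exact: On_lePi. Qed.

Section Segment.
Variables (A : wellOrder) (a : A).

Let T := {x : A | ~~ wo_le a x}.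
Let le : rel T := fun x y => wo_le (sval x) (sval y).

Lemma wo_seg_subproof : wochoice.well_order le.
Proof.
move=> P [x Px].
have [|z [y Py <-] zmin] := @wo_min A [set sval x | x in [set x | x \in P]].
  by exists (sval x), x.
have ymin : {in P, forall t, le y t} by move=> t Pt; apply: zmin; exists t.
exists y; split=> [//|t [Pt tmin]]; apply/val_inj.
by apply: wo_anti; [exact: ymin|exact: tmin].
Qed.

Definition wo_seg := WellOrder wo_seg_subproof.

End Segment.

Lemma wo_seg_le (A : wellOrder) (a b : A) :
  wo_le a b -> \pi_On (wo_seg a) <= \pi_On (wo_seg b).
Proof.
move=> ab; apply/On_leP.
have sub (x : A) : ~~ wo_le a x -> ~~ wo_le b x.
  by apply: contra; exact: wo_trans.
exists (fun x : wo_seg a => exist _ (sval x) (sub _ (svalP x)) : wo_seg b).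
split=> // x y yx; have lt : ~~ wo_le a (sval y).
  by apply: contra (svalP x) => /wo_trans; exact.
by exists (exist _ (sval y) lt); exact: val_inj.
Qed.

Lemma wo_seg_initial (A : wellOrder) (a : A) :
  initial_embedding (sval : wo_seg a -> A).
Proof.
split=> [//|x b bx]; have lt : ~~ wo_le a b.
  by apply: contra (svalP x) => /wo_trans; exact.
by exists (exist _ b lt).
Qed.

Lemma wo_seg_lt (A : wellOrder) (a : A) : \pi_On (wo_seg a) < \pi_On A.
Proof.
rewrite ltNge; apply/negP => /On_leP[f [mf jf]].
have [ms js] := wo_seg_initial a.
have : initial_embedding (fun x : A => sval (f x)).
  split=> [x y|x b]; first by rewrite ms mf.
  move=> /[dup] h /js[c cb]; move: h; rewrite -cb ms => /jf[y <-].
  by exists y.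
move=> /initial_embedding_uniq/(_ _ a) e.
have := svalP (f a); rewrite (e id) ?wo_refl//.
by split=> // x b _; exists b.
Qed.

Lemma wo_seg_inj (A : wellOrder) : injective (fun a : A => \pi_On (wo_seg a)).
Proof.
suff le (a b : A) : \pi_On (wo_seg a) = \pi_On (wo_seg b) -> wo_le a b.
  by move=> a b e; apply: wo_anti; exact: le.
move=> /On_eqP/wo_iso_emb[f [mf jf]]; apply: contraT => ba.
have [ms js] := wo_seg_initial b.
have : initial_embedding (fun x : wo_seg a => sval (f x)).
  split=> [x y|x c]; first by rewrite ms mf.
  move=> /[dup] h /js[d dc]; move: h; rewrite -dc ms => /jf[y <-].
  by exists y.
move=> /initial_embedding_uniq/(_ (wo_seg_initial a) (exist _ b ba)) /= e.
by have := svalP (f (exist _ b ba)); rewrite e wo_refl.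
Qed.

Lemma On_lt_seg (A : wellOrder) (o : On) : o < \pi_On A ->
  exists a : A, o = \pi_On (wo_seg a).
Proof.
rewrite -[o]reprK => oA; have /On_leP[f [mf jf]] := ltW oA.
have [a na mina] : exists2 a, ~ (exists x, f x = a) &
    forall b, ~ (exists x, f x = b) -> wo_le a b.
  apply: (@wo_min A [set a | ~ exists x, f x = a]).
  apply: contrapT => /forallNP surj.
  have {}surj a : exists x, f x = a by apply: contrapT; exact: surj.
  suff /On_eqP e : wo_iso (repr o) A by rewrite e ltxx in oA.
  have [g gP] := choice surj; exists f => //; exists g => // x.
  by apply: wo_anti; rewrite -mf gP wo_refl.
exists a; apply/On_eqP.
have fa x : ~~ wo_le a (f x) by apply/negP => /jf.
pose h x : wo_seg a := exist _ (f x) (fa x).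
have /choice[g gP] (y : wo_seg a) : exists x, f x = sval y.
  by apply: contrapT => /mina; exact/negP/(svalP y).
exists h; last by move=> x y; exact: mf.
exists g => [x|y]; last exact/val_inj/gP.
by apply: wo_anti; rewrite -mf gP wo_refl.
Qed.

Lemma On_wf (P : set On) : P !=set0 -> P `&` lbound P !=set0.
Proof.
move=> [o Po]; have [lb|nlb] := pselect (lbound P o); first by exists o.
have ltP o' : o' < o -> exists y : repr o, o' = \pi_On (wo_seg y).
  by rewrite -{1}[o]reprK => /On_lt_seg.
have [|y Py ymin] := @wo_min (repr o) [set y | P (\pi_On (wo_seg y))].
  move/existsNP: nlb => [o' /not_implyP[Po' /negP]].
  by rewrite -ltNge => /ltP[y oy]; exists y; rewrite /= -oy.
exists (\pi_On (wo_seg y)); split=> // o' Po'.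
have [oo'|/ltP[z oz]] := leP o o'; last first.
  by rewrite oz; apply: wo_seg_le; apply: ymin; rewrite /= -oz.
apply: le_trans oo'; rewrite -[X in _ <= X]reprK; apply/On_leP.
by exists sval; exact: wo_seg_initial.
Qed.

Definition On_min (o0 : On) (P : set On) := xget o0 (P `&` lbound P).

Lemma On_minP o0 (P : set On) : P !=set0 ->
  P (On_min o0 P) /\ lbound P (On_min o0 P).
Proof. by move=> /On_wf[o oP]; exact: (xgetI o0 oP). Qed.

Definition seg (o : On) := {x : On | x < o}.

Definition is_cardinal (o : On) :=
  forall o', o' < o -> ~~ ([set: seg o] #<= [set: seg o']).

(* The default value k of On_min is never used, see succ_cardP. *)
Definition succ_card (k : On) := On_min k [set m | is_cardinal m /\ k < m].

Definition cofinal_map (d o : On) (h : seg d -> seg o) :=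
  forall x : seg o, exists y : seg d, val x <= val (h y).

(* The default value o of On_min is never used, see cofP. With this definition
   cof 0 = 0 and the cofinality of a successor is 1. *)
Definition cof (o : On) := On_min o [set d | exists h, @cofinal_map d o h].

Lemma card_leTT T U :
  ([set: T] #<= [set: U]) <-> exists f : T -> U, injective f.
Proof.
split=> [/card_leP[f]|[f fI]].
  exists (fun x => val (f (to_setT x))) => x y /val_inj/inj e.
  by have /(congr1 val) := e (mem_setT _) (mem_setT _).
have [g] : $|{injfun [set: T] >-> [set: U]}|.
  by apply/injfunPex; exists f => // x y _ _; exact: fI.
exact: inj_card_le.
Qed.

Lemma card_seg_le (a b : On) : a <= b -> [set: seg a] #<= [set: seg b].
Proof.
move=> ab; apply/card_leTT.
exists (fun x : seg a => exist _ (val x) (lt_le_trans (valP x) ab) : seg b).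
by move=> x y [] /val_inj.
Qed.

Lemma card_seg (A : wellOrder) : [set: seg (\pi_On A)] #= [set: A].
Proof.
rewrite card_eq_le; apply/andP; split; apply/card_leTT.
  have /choice[f fP] (x : seg (\pi_On A)) :
    exists a : A, val x = \pi_On (wo_seg a) by exact/On_lt_seg/(valP x).
  by exists f => x y e; apply: val_inj; rewrite (fP x) (fP y) e.
exists (fun a : A => exist _ (\pi_On (wo_seg a)) (wo_seg_lt a)).
by move=> x y [] /wo_seg_inj.
Qed.

Lemma succ_cardP (k : On) : let P := [set m | is_cardinal m /\ k < m] in
  P (succ_card k) /\ lbound P (succ_card k).
Proof.
apply: On_minP.
pose Q := [set m | ~~ ([set: seg m] #<= [set: seg k])].
have [m [Qm mmin]] : Q `&` lbound Q !=set0.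
  apply: On_wf; pose A : Type := repr k.
  have [R Rwo] := wochoice.well_ordering_principle (A -> Prop).
  pose W := @WellOrder (A -> Prop) R Rwo.
  exists (\pi_On W); apply/negP => le.
  have : [set: A -> Prop] #<= [set: A].
    rewrite (card_le_eql (card_esym (card_seg W))).
    rewrite -(card_le_eqr (card_seg (repr k))) reprK.
    exact: le.
  move=> /card_leTT[f fI].
  pose D a := exists2 P, f P = a & ~ P a.
  have DP : ~ D (f D) by move=> /[dup] h [P /fI ->]; exact.
  by apply: (DP); exists D.
exists m; split=> [o' o'm|].
  have le : [set: seg o'] #<= [set: seg k].
    by apply: contraT => /mmin; rewrite leNgt o'm.
  by apply: contra Qm => /card_le_trans; exact.
by rewrite ltNge; apply: contra Qm; exact: card_seg_le.
Qed.

Lemma cofP (o : On) : let P := [set d | exists h, @cofinal_map d o h] in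
  P (cof o) /\ lbound P (cof o).
Proof. by apply: On_minP; exists o, id => x; exists x. Qed.

Section Modulo.
Variable T : Type.
Implicit Types (I F : set_system T) (f g : T -> On) (t s : set T).

Definition dual F : set_system T := [set X | F (~` X)].

Definition lt_mod I f g := I [set i | f i >= g i].
Definition le_mod I f g := I [set i | f i > g i].

Definition increasing_mod I (l : On) (fs : seg l -> T -> On) :=
  forall a b : seg l, val a < val b -> lt_mod I (fs a) (fs b).

Definition exact_upper_bound I (l : On) (fs : seg l -> T -> On) f :=
  (forall a, le_mod I (fs a) f) /\
  forall g, lt_mod I g f -> exists a, lt_mod I g (fs a).

Definition subset_mod I t s := I (t `\` s).
Definition eq_mod I t s := subset_mod I t s /\ subset_mod I s t.

Definition stabilizes_mod I (l : On) (ts : seg l -> set T) :=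
  exists a0 : seg l, forall a, val a0 <= val a -> eq_mod I (ts a) (ts a0).

End Modulo.

(* Main.v *)
Require Import Defs.
From mathcomp Require Import all_boot all_order.
From mathcomp Require Import boolp classical_sets functions cardinality filter.

Set Implicit Arguments.
Unset Strict Implicit.
Unset Printing Implicit Defensive.

Import Order.TTheory.

Local Open Scope classical_set_scope.
Local Open Scope order_scope.
Local Open Scope card_scope.
Local Open Scope quotient_scope.

(* We build functions f_a, g_a (a < k^+) and an ultrafilter U such that
   f_a < f_b < g_b < g_a mod U whenever a < b, while for every fixed i the
   intervals (f_a(i), g_a(i)) are so sparse that each ordinal lies in only
   countably many of them. If h_a(i) lies in S(i) with |S(i)| <= k and
   f_a < h_a < g_a mod U for all a, then sending a to some i with
   f_a(i) < h_a(i) < g_a(i), to h_a(i) and to a natural number injects k^+ into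
   a set of size k. This refutes (2), and also (1) with S(i) = {f(i)}: an exact
   upper bound f lies below all g_a, as otherwise some g_b < f would lie above
   all f_a. Condition (3) fails for every ultrafilter.

   For fixed i the interval of a is a node of a tree of finite depth n_i: it
   consists of the words, in a lexicographic power of k^+, that extend a word
   p a, where p is a list of elements below a. As there are only k lists below
   a, a dense set of k functions k^+ -> k provides for every finite
   subset E of k^+ an i such that p is, for all a in E, the list of the elements of E
   below a; this makes E a chain of intervals at i, and gives the finite
   intersection property needed for U. *)

(** * Injections between types, and types that absorb their square *)

Definition embeds (X Y : Type) := exists f : X -> Y, injective f.

Lemma embeds_trans (X Y Z : Type) : embeds X Y -> embeds Y Z -> embeds X Z.
Proof. by move=> [f fI] [g gI]; exists (g \o f); exact: inj_comp. Qed.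

Lemma embeds_prod (X X' Y Y' : Type) :
  embeds X X' -> embeds Y Y' -> embeds (X * Y) (X' * Y').
Proof.
move=> [f fI] [g gI]; exists (fun p => (f p.1, g p.2)).
by move=> [x y] [x' y'] /= [/fI-> /gI->].
Qed.

Lemma embeds_surj (X Y : Type) (x0 : X) : embeds X Y ->
  exists h : Y -> X, forall x, exists y, h y = x.
Proof.
move=> [f fI].
have /choice[h hP] (y : Y) : exists x, (exists x', f x' = y) -> f x = y.
  by have [[x <-]|n] := pselect (exists x', f x' = y); [exists x|exists x0].
by exists h => x; exists (f x); apply/fI/hP; exists x.
Qed.

Section SquareClosed.
Variable B : Type.
Hypotheses (natB : embeds nat B) (sqB : embeds (B * B) B).

Lemma embeds_bool : embeds bool B.
Proof. by apply: embeds_trans natB; exists nat_of_bool; case; case. Qed.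

Lemma embeds_prodl (X Y : Type) : embeds X B -> embeds Y B -> embeds (X * Y) B.
Proof. by move=> XB YB; apply: embeds_trans sqB; exact: embeds_prod. Qed.

(** Iterated pairing alone may confuse lists of different lengths, so the length is coded as
    well. *)
Lemma embeds_seq (X : Type) : embeds X B -> embeds (seq X) B.
Proof.
move=> [f fI]; have [p pI] := sqB; have [c _] := natB.
pose code := foldr (fun x b => p (f x, b)) (c 0%N).
apply: (@embeds_trans _ (nat * B)).
  exists (fun s => (size s, code s)).
  elim=> [|x s IH] [|y t] //= [st /pI[/fI-> e]].
  by rewrite (IH t) // st e.
by apply: embeds_prodl => //; exists id.
Qed.

End SquareClosed.

(** * Constructions of well-orders *)

Section Pullback.
Variables (T : Type) (A : wellOrder) (f : T -> A).
Hypothesis fI : injective f.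

Let le : rel T := fun x y => wo_le (f x) (f y).

Lemma wo_pullback_subproof : wochoice.well_order le.
Proof.
move=> P [x Px].
have [|z [y Py <-] zmin] := @wo_min A [set f x | x in [set x | x \in P]].
  by exists (f x), x.
have ymin : {in P, forall t, le y t} by move=> t Pt; apply: zmin; exists t.
exists y; split=> [//|t [Pt tmin]]; apply/fI.
by apply: wo_anti; [exact: ymin|exact: tmin].
Qed.

Definition wo_pullback := WellOrder wo_pullback_subproof.

End Pullback.

Section Lex.
Variables A B : wellOrder.

Let le : rel (A * B) := fun p q =>
  wo_le p.1 q.1 && (wo_le q.1 p.1 ==> wo_le p.2 q.2).

Lemma wo_lex_subproof : wochoice.well_order le.
Proof.
move=> P [[x y] Pxy].
have [|a [b Pab] amin] := @wo_min A [set a | exists b, (a, b) \in P].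
  by exists x, y.
have [|c Pac cmin] := @wo_min B [set b | (a, b) \in P]; first by exists b.
have min : {in P, forall t, le (a, c) t}.
  move=> [u v] Puv; rewrite /le /= amin /=; last by exists v.
  apply/implyP => ua; apply: cmin => /=.
  have au : wo_le a u by apply: amin; exists v.
  by rewrite (wo_anti au ua).
exists (a, c); split=> [//|[u v] [Puv uvmin]].
have := min _ Puv; have := uvmin _ Pac; rewrite /le /=.
move=> /andP[ua /implyP vc] /andP[au /implyP cv].
by rewrite (wo_anti au ua) (wo_anti (cv ua) (vc au)).
Qed.

Definition wo_lex := WellOrder wo_lex_subproof.

End Lex.

Lemma wo_nat_subproof : wochoice.well_order leq.
Proof.
move=> P nP; have minP := ex_minnP nP; case: minP => m Pm mmin.
exists m; split=> [//|n [Pn nmin]].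
by apply/eqP; rewrite eqn_leq; apply/andP; split; [exact: mmin|exact: nmin].
Qed.

Definition wo_nat := WellOrder wo_nat_subproof.

Lemma embeds_segE (a b : On) :
  ([set: seg a] #<= [set: seg b]) <-> embeds (seg a) (seg b).
Proof. exact: card_leTT. Qed.

Lemma seg_pi (A : wellOrder) :
  embeds (seg (\pi_On A)) A /\ embeds A (seg (\pi_On A)).
Proof.
have := card_seg A; rewrite card_eq_le => /andP[h1 h2].
by split; apply/card_leTT.
Qed.

Lemma seg_repr (o : On) : embeds (seg o) (repr o) /\ embeds (repr o) (seg o).
Proof. by have := seg_pi (repr o); rewrite reprK. Qed.

(** * Hessenberg's theorem on squares of infinite ordinals *)

Definition wo_max (A : wellOrder) (x y : A) := if wo_le x y then y else x.

Lemma wo_max_ge (A : wellOrder) (x y : A) :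
  wo_le x (wo_max x y) /\ wo_le y (wo_max x y).
Proof.
rewrite /wo_max; case: ifPn => xy; split=> //; try exact: wo_refl.
exact: wo_ltW.
Qed.

Section CanonicalSquare.
Variable A : wellOrder.

(** Gödel's canonical order of pairs: as the maximum is compared first, every proper initial segment
    lies in the square of a closed initial segment of [A]. *)
Definition square_key (p : A * A) : wo_lex A (wo_lex A A) :=
  (wo_max p.1 p.2, (p.1, p.2)).

Lemma square_key_inj : injective square_key.
Proof. by move=> [x y] [x' y'] [_ -> ->]. Qed.

Definition wo_square := wo_pullback square_key_inj.

Lemma wo_square_seg (p q : wo_square) : ~~ wo_le p q ->
  wo_le q.1 (wo_max p.1 p.2) /\ wo_le q.2 (wo_max p.1 p.2).
Proof.
move=> /wo_ltW /andP[/= le _].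
by have [h1 h2] := wo_max_ge q.1 q.2; split; exact: wo_trans le.
Qed.

End CanonicalSquare.

Lemma infinite_embeds (T : Type) : infinite_set [set: T] <-> embeds nat T.
Proof. by rewrite infiniteP; exact: card_leTT. Qed.

(** Take a least counterexample o. If the canonical order of its square is longer than o, then o is
    a proper initial segment of it and embeds into the square of m + 1 for some infinite m < o; by
    minimality m absorbs this square. *)
Lemma embeds_square (o : On) : infinite_set [set: seg o] ->
  embeds (seg o * seg o) (seg o).
Proof.
apply: contraPP => bad0 inf0.
pose P := [set o | infinite_set [set: seg o] /\ ~ embeds (seg o * seg o) (seg o)].
have [|{bad0 inf0} {}o [[inf bad] omin]] := @On_wf P; first by exists o.
apply: bad; have [so ro] := seg_repr o.
have [le|] := leP (\pi_On (wo_square (repr o))) o.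
  apply: (@embeds_trans _ (repr o * repr o)); first exact: embeds_prod.
  apply: (@embeds_trans _ (seg (\pi_On (wo_square (repr o))))).
    exact: (seg_pi (wo_square (repr o))).2.
  exact/embeds_segE/card_seg_le.
move=> /On_lt_seg[w ow]; pose m := wo_max w.1 w.2.
pose M := \pi_On (wo_seg m).
have [_ rM] := seg_pi (wo_seg m); rewrite -/M in rM.
(* [None] stands for m itself, the top of the closed segment. *)
have oM : embeds (seg o) (option (wo_seg m) * option (wo_seg m)).
  have /choice[f fP] (x : repr o) : exists y : option (wo_seg m),
      wo_le x m -> x = oapp sval m y.
    have [mx|xm] := boolP (wo_le m x); last by exists (Some (exist _ x xm)).
    by exists None => xm /=; exact: wo_anti.
  apply: (@embeds_trans _ (wo_seg w)).
    by rewrite [in seg o]ow; exact: (seg_pi (wo_seg w)).1.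
  exists (fun q : wo_seg w => (f (sval q).1, f (sval q).2)).
  move=> q q' [e1 e2]; apply: val_inj; apply: square_key_inj.
  have [h1 h2] := wo_square_seg (valP q); have [h1' h2'] := wo_square_seg (valP q').
  rewrite /square_key (fP _ h1) (fP _ h2) (fP _ h1') (fP _ h2').
  by rewrite e1 e2.
have infM : infinite_set [set: wo_seg m].
  move=> finM; have fino : finite_set [set: option (wo_seg m)].
    apply: sub_finite_set (_ : _ `<=` None |` [set Some x | x in setT]) _.
      by move=> [x|] _; [right; exists x|left].
    by rewrite finite_setU; split; [exact: finite_set1|exact: finite_image].
  have : infinite_set ([set: option (wo_seg m)] `*` [set: option (wo_seg m)]).
    rewrite setXTT; apply/infinite_embeds; apply: embeds_trans oM.
    exact/infinite_embeds.
  by apply; exact: finite_setX.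
have natM : embeds nat (seg M).
  by apply: embeds_trans rM; exact/infinite_embeds.
have sqM : embeds (seg M * seg M) (seg M).
  apply: contrapT => bad; have : P M by split=> //; exact/infinite_embeds.
  move=> /omin; rewrite leNgt => /negP; apply.
  by rewrite /M -[X in _ < X]reprK; exact: wo_seg_lt.
have optM : embeds (option (wo_seg m)) (seg M).
  apply: (@embeds_trans _ (bool * seg M)).
    have [g gI] := rM; have [c _] := natM.
    exists (fun y => if y is Some x then (true, g x) else (false, c 0%N)).
    by move=> [x|] [y|] //= [] /gI->.
  by apply: embeds_prodl => //; [exact: embeds_bool|exists id].
have oM' : embeds (seg o) (seg M).
  by apply: embeds_trans oM _; exact: embeds_prodl.
apply: (@embeds_trans _ (seg M)); first exact: embeds_prodl.
apply/embeds_segE/card_seg_le/ltW.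
by rewrite /M -[X in _ < X]reprK; exact: wo_seg_lt.
Qed.

Lemma wo_seg_ltE (A : wellOrder) (x y : A) :
  (\pi_On (wo_seg x) < \pi_On (wo_seg y)) = ~~ wo_le y x.
Proof.
apply/idP/idP => [|yx]; first by apply: contraTN => /wo_seg_le; rewrite leNgt.
rewrite lt_neqAle; apply/andP; split; last exact: wo_seg_le (wo_ltW yx).
by apply: contraNN yx => /eqP/wo_seg_inj->; exact: wo_refl.
Qed.

(** * Lexicographic powers and intervals of words *)

Section LexPower.
Variables (A : wellOrder) (z : A).
Hypothesis z_min : forall x, wo_le z x.

Fixpoint wo_power n : wellOrder :=
  if n is m.+1 then wo_lex A (wo_lex wo_nat (wo_power m)) else wo_nat.

(* Letters of words longer than n are ignored; shorter words are padded with
   (z, 0), which is smaller than every letter (x, i.+1). *)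
Fixpoint word n (s : seq (A * nat)) : wo_power n :=
  match n with
  | 0 => 0%N
  | m.+1 => if s is x :: s' then (x.1, (x.2, word m s'))
            else (z, (0%N, word m [::]))
  end.

Fixpoint coord n : wo_power n -> nat -> A :=
  match n with
  | 0 => fun _ _ => z
  | m.+1 => fun y j => if j is j'.+1 then coord y.2.2 j' else y.1
  end.

Lemma wo_powerE n (x x' : A) (i i' : nat) (y y' : wo_power n) :
  wo_le ((x, (i, y)) : wo_power n.+1) (x', (i', y')) =
  wo_le x x' && (wo_le x' x ==> (i <= i')%N && ((i' <= i)%N ==> wo_le y y')).
Proof. by []. Qed.

Lemma word_cat p m s s' :
  wo_le (word (size p + m) (p ++ s)) (word (size p + m) (p ++ s')) =
  wo_le (word m s) (word m s').
Proof.
elim: p => [//|[x i] p IH].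
by rewrite -IH [LHS]wo_powerE /= !wo_refl !leqnn.
Qed.

Lemma word_nil_lt m x i s :
  ~~ wo_le (word m.+1 ((x, i.+1) :: s)) (word m.+1 [::]).
Proof. by rewrite wo_powerE z_min ltn0 /= andbF. Qed.

Lemma word_head_lt m x i j s s' : (i < j)%N ->
  ~~ wo_le (word m.+1 ((x, j) :: s)) (word m.+1 ((x, i) :: s')).
Proof. by move=> ij; rewrite wo_powerE wo_refl (leqNgt j) ij. Qed.

(** Tag 0 is left to the padding. For [size p < n] the words from [node 1] up to, but excluding,
    [node 2] are thus exactly those extending p a with tags 1; these two words are the endpoints of
    the interval of a. *)
Definition node i n (p : seq A) a :=
  word n (rcons [seq (x, 1%N) | x <- p] (a, i)).

Lemma node_lt n p a i j : (size p < n)%N -> (i < j)%N ->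
  ~~ wo_le (node j n p a) (node i n p a).
Proof.
move=> pn ij; have -> : n = (size [seq (x, 1%N) | x <- p] + (n - (size p).+1).+1)%N.
  by rewrite size_map addnS -addSn subnKC.
by rewrite /node -!cats1 word_cat word_head_lt.
Qed.

(** At the lower ends the words agree on p a, and then the padding loses against a letter with tag
    1. At the upper ends the tags 1 and 2 of a decide. *)
Lemma node_nested n p a r b : (size (p ++ a :: r) < n)%N ->
  ~~ wo_le (node 1 n (p ++ a :: r) b) (node 1 n p a) /\
  ~~ wo_le (node 2 n p a) (node 2 n (p ++ a :: r) b).
Proof.
move=> pn; have e : n = (size [seq (x, 1%N) | x <- p] + (n - (size p).+2).+2)%N.
  rewrite size_map !addnS -!addSn subnKC //; apply: leq_trans pn.
  by rewrite size_cat /= addnS !ltnS leq_addr.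
rewrite e /node -!cats1 map_cat -!catA !word_cat; split; last exact: word_head_lt.
rewrite (word_cat [:: (a, 1%N)] (n - (size p).+2).+1 _ [::]).
by case: r {pn e} => [|c r]; exact: word_nil_lt.
Qed.

Lemma word_consE n x k s (y : A) (i : nat) (v : wo_power n) :
  wo_le (word n.+1 ((x, k) :: s)) (y, (i, v)) =
  wo_le x y && (wo_le y x ==> (k <= i)%N && ((i <= k)%N ==> wo_le (word n s) v)).
Proof. by []. Qed.

(** This is the sparseness of the intervals: a point recovers a from the depth [size p], so it lies
    in at most one interval of each depth. *)
Lemma node_coord n p a (y : wo_power n) :
  wo_le (node 1 n p a) y -> ~~ wo_le (node 2 n p a) y -> coord y (size p) = a.
Proof.
rewrite /node; elim: p n y => [|x p IH] [|n].
- by move=> y h /negP[].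
- move=> [y [i v]]; rewrite !word_consE => /andP[ay _].
  by rewrite ay /= negb_imply => /andP[ya _]; exact: wo_anti.
- by move=> y h /negP[].
- move=> [y [i v]]; rewrite map_cons !rcons_cons !word_consE.
  move=> /andP[-> /implyP h] /=.
  rewrite negb_imply => /andP[/h/andP[-> /implyP h'] /=].
  by rewrite negb_imply => /andP[/h'] /IH /[apply].
Qed.

End LexPower.

(** * Dense families of functions *)

(** For each element of s, one coordinate where its code differs from that of a is added to the
    test. *)
Lemma separating_test (L : eqType) (B : Type) (x : L -> B -> bool) (a : L)
    (s : seq L) : injective x -> a \notin s ->
  exists D : seq (B * bool), all (fun p => x a p.1 == p.2) D /\
    {in s, forall b, ~~ all (fun p => x b p.1 == p.2) D}.
Proof.
move=> xI; elim: s => [|b s IH]; first by exists [::].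
rewrite inE negb_or => /andP[ab /IH[D [aD sD]]].
have [c nc] : exists c, x a c <> x b c.
  apply: contrapT => /forallNP h; move/eqP: ab; apply; apply: xI.
  by apply/funext => c; apply: contrapT; exact: h.
exists ((c, x a c) :: D); split=> [|b']; first by rewrite /= eqxx.
rewrite inE => /predU1P[->|/sD /negbTE /= ->]; last by rewrite andbF.
by rewrite /= eq_sym (introF eqP nc).
Qed.

(* Hewitt-Marczewski-Pondiczery: the product of 2^|B| discrete spaces of size
   at most |B| has a dense subset of size |B|. *)
Lemma dense_family (L : eqType) (B V : Type) (v0 : V) :
  embeds nat B -> embeds (B * B) B -> embeds L (B -> bool) -> embeds V B ->
  exists u : B -> L -> V, forall (s : seq L) (v : L -> V),
    exists i, {in s, forall a, u i a = v a}.
Proof.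
move=> natB sqB [x xI] VB.
have [|h hs] := @embeds_surj (seq (seq (B * bool) * V)) B [::].
  apply: embeds_seq => //; apply: embeds_prodl => //; apply: embeds_seq => //.
  by apply: embeds_prodl => //; [exists id|exact: embeds_bool].
(* An index codes a decision list, and [look] returns the value of the first test passed. A rule put
   in front for a new element a fires at a but not on the elements already treated. *)
pose look a := foldr (fun (r : seq (B * bool) * V) w =>
  if all (fun p => x a p.1 == p.2) r.1 then r.2 else w) v0.
exists (fun i a => look a (h i)) => s v.
have [c cP] : exists c, {in s, forall a, look a c = v a}.
  elim: s => [|a s [c cP]]; first by exists [::].
  have [as_|nas] := boolP (a \in s).
    by exists c => b; rewrite inE => /predU1P[->|]; exact: cP.
  have [D [aD sD]] := separating_test xI nas.
  exists ((D, v a) :: c) => b; rewrite inE => /predU1P[->|bs] /=.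
    by rewrite aD.
  by rewrite (negbTE (sD _ bs)); exact: cP.
by have [i hi] := hs c; exists i => a sa; rewrite hi; exact: cP.
Qed.

(** * The successor cardinal *)

(** The least ordinal into which o embeds is a cardinal not above o, so it lies below [succ_card k]
    and cannot exceed k. *)
Lemma succ_card_embeds (k o : On) : o < succ_card k -> embeds (seg o) (seg k).
Proof.
move=> ok; pose P := [set m | [set: seg o] #<= [set: seg m]].
have [|m [Pm mmin]] := @On_wf P; first by exists o; exact: card_lexx.
have mo : m <= o by apply: mmin; exact: card_lexx.
have m_card : is_cardinal m.
  move=> o' o'm; apply/negP => h; have : P o' by exact: card_le_trans h.
  by move=> /mmin; rewrite leNgt o'm.
apply: (@embeds_trans _ (seg m)); first exact/embeds_segE.
apply/embeds_segE/card_seg_le; rewrite leNgt; apply/negP => km.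
have [_ /(_ m (conj m_card km))] := succ_cardP k.
by rewrite leNgt (le_lt_trans mo).
Qed.

Lemma succ_card_not_embeds (k : On) : ~ embeds (seg (succ_card k)) (seg k).
Proof.
have [[c kS] _] := succ_cardP k.
by move=> /embeds_segE; exact/negP/c.
Qed.

(** Well-order the power set of k: if its type were below [succ_card k], it would embed into k,
    against Cantor's diagonal. *)
Lemma embeds_powerset (k : On) : seg k ->
  embeds (seg (succ_card k)) (seg k -> bool).
Proof.
move=> x0; pose A : Type := repr k; have [sk rk] := seg_repr k.
have [R Rwo] := wochoice.well_ordering_principle (A -> bool).
pose W := @WellOrder (A -> bool) R Rwo.
have [sW rW] := seg_pi W.
apply: (@embeds_trans _ W); last first.
  have [h hs] : exists h : seg k -> A, forall x, exists y, h y = x.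
    by have [f _] := sk; exact: embeds_surj (f x0) rk.
  exists (fun (X : A -> bool) i => X (h i)) => X Y XY; apply/funext => a.
  by have [i <-] := hs a; exact: (congr1 (fun Z : seg k -> bool => Z i) XY).
apply: embeds_trans sW; apply/embeds_segE/card_seg_le.
rewrite leNgt; apply/negP => /succ_card_embeds Wk.
have [f fI] : embeds (A -> bool) A.
  by apply: embeds_trans rW _; apply: embeds_trans Wk _.
pose D a := `[< exists2 X, f X = a & ~~ X a >].
have DP : ~~ D (f D).
  by apply/negP => /[dup] h /asboolP[X /fI -> /negP]; exact.
by move: (DP); apply/negP/negPn/asboolP; exists D.
Qed.

(** * Finite lists below an element, and unboundedness of the successor cardinal *)

(** It puts the list belonging to b into the form required by [node_nested]: the list of a, then a,
    then a remainder. *)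
Lemma filter_lt_split (T : eqType) (v : T -> On) (a b : T) (E : seq T) :
  sorted (fun x y => v x < v y) E -> a \in E -> v a < v b ->
  [seq x <- E | v x < v b] =
  [seq x <- E | v x < v a] ++ a :: [seq x <- E | v a < v x < v b].
Proof.
move=> + + ab; elim: E => [//|e E IH] /= pE.
have eE : all (fun x => v e < v x) E.
  by apply: order_path_min pE => x y t; exact: lt_trans.
rewrite inE => /predU1P[ae|aE].
  rewrite -ae ab ltxx /=.
  have -> : [seq x <- E | v x < v a] = [::].
    apply/eqP; rewrite -(negbK (_ == _)) -has_filter; apply/hasPn => x /(allP eE).
    by rewrite -ae -leNgt => /ltW.
  by rewrite /=; congr cons; apply: eq_in_filter => x /(allP eE); rewrite -ae => ->.
have ea := allP eE _ aE; rewrite ea (lt_trans ea ab) (lt_gtF ea) /=.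
by rewrite (IH (path_sorted pE) aE).
Qed.

(** At most k elements lie below a, so k names suffice for their finite lists; a function with
    values in k can thus guess such lists. *)
Lemma seq_names (k : On) (a : seg (succ_card k)) :
  infinite_set [set: seg k] ->
  exists d : seg k -> seq (seg (succ_card k)), forall s,
    all (fun x => val x < val a) s -> exists i, d i = s.
Proof.
move=> /[dup] /embeds_square sqk /infinite_embeds natk.
have [|h hs] := @embeds_surj (seq (seg (val a))) (seg k) [::].
  by apply: embeds_seq => //; exact: succ_card_embeds (valP a).
pose up (x : seg (val a)) : seg (succ_card k) :=
  exist _ (val x) (lt_trans (valP x) (valP a)).
exists (fun i => map up (h i)) => s sa.
have [t <-] : exists t, map up t = s.
  elim: s sa => [|x s IH] /=; first by exists [::].
  move=> /andP[xa /IH[t <-]]; exists (exist _ (val x) xa :: t) => /=.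
  by congr cons; exact: val_inj.
by have [i hi] := hs t; exists i; rewrite hi.
Qed.

(** With a top element a, the successor would consist of a segment of size at most k and one more
    point, and would embed into k. *)
Lemma succ_card_unbounded (k : On) (a : seg (succ_card k)) :
  infinite_set [set: seg k] -> exists b : seg (succ_card k), val a < val b.
Proof.
move=> /[dup] /embeds_square sqk /infinite_embeds natk.
apply: contrapT => /forallNP top; apply: (@succ_card_not_embeds k).
have [e eI] := succ_card_embeds (valP a); have [c _] := natk.
apply: (@embeds_trans _ (bool * seg k)); last first.
  by apply: embeds_prodl => //; [exact: embeds_bool|exists id].
have /choice[h hP] (x : seg (succ_card k)) : exists p : bool * seg k,
    if p.1 then exists2 y : seg (val a), val y = val x & p.2 = e y
    else val x = val a.
  have [xa|] := ltP (val x) (val a).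
    by exists (true, e (exist _ (val x) xa)); exists (exist _ (val x) xa).
  rewrite le_eqVlt => /orP[/eqP ax|ax]; first by exists (false, c 0%N).
  by have := top x; rewrite ax.
exists h => x y xy; apply: val_inj; have := hP x; have := hP y; rewrite xy.
case: (h y).1 => [[u <- ->] [w <- /eI->//]|-> ->//].
Qed.

(** * The nested intervals *)

Lemma nested_intervals (k : On) : infinite_set [set: seg k] ->
  exists (f g : seg (succ_card k) -> seg k -> On)
         (rk : seg (succ_card k) -> seg k -> nat),
    (forall s : seq (seg (succ_card k)), exists i, {in s &, forall a b,
       val a < val b ->
       [/\ f a i < f b i, f b i < g b i & g b i < g a i]}) /\
    (forall a b i o, f a i < o < g a i -> f b i < o < g b i ->
       rk a i = rk b i -> a = b).
Proof.
move=> k_inf; set L := seg (succ_card k).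
have sqk := embeds_square k_inf; have /infinite_embeds natk := k_inf.
have [x0 _] := infinite_setN0 k_inf.
have [l lI] := (seg_repr (succ_card k)).1.
set A := repr (succ_card k) in l lI.
have [z _ zmin] : exists2 z : A, setT z & forall x, setT x -> wo_le z x.
  apply: wo_min; have [[_ kS] _] := succ_cardP k.
  by exists (l (exist _ k kS)).
have {}zmin x : wo_le z x by exact: zmin.
have /choice[d dP] (a : L) := seq_names a k_inf.
have [u uP] := dense_family x0 natk sqk (embeds_powerset x0)
  (ex_intro _ id (fun _ _ => id) : embeds (seg k) (seg k)).
(* An index i codes the depth of its tree together with an index into the dense family. *)
have [h hs] := embeds_surj (0%N, x0)
  (embeds_prodl sqk natk (ex_intro _ id (fun _ _ => id))).
(* The guess at i for the list p of a; its length serves as the rank of a. *)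
pose pre (a : L) i := d a (u (h i).2 a).
pose I e (a : L) i := \pi_On (wo_seg (node z e (h i).1 (map l (pre a i)) (l a))).
exists (I 1%N), (I 2%N), (fun a i => size (pre a i)); split; last first.
  move=> a b i o /andP[ao oa] /andP[bo ob] e; apply: lI.
  have [y oy] : exists y : wo_power A (h i).1, o = \pi_On (wo_seg y).
    exact/On_lt_seg/(lt_trans oa)/wo_seg_lt.
  move: ao oa bo ob; rewrite oy !wo_seg_ltE => ao oa bo ob.
  have := node_coord (wo_ltW ao) oa; have := node_coord (wo_ltW bo) ob.
  by rewrite !size_map e => -> ->.
move=> s; pose E := sort (fun x y : L => val x <= val y) (undup s).
have Es x : (x \in E) = (x \in s) by rewrite mem_sort mem_undup.
have E_sorted : sorted (fun x y : L => val x < val y) E.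
  have : sorted (fun x y : L => val x <= val y) E.
    by apply: sort_sorted => x y; exact: le_total.
  have : uniq (map val E).
    by rewrite map_inj_uniq ?sort_uniq ?undup_uniq //; exact: val_inj.
  move=> uE sE; have : sorted <%O (map val E).
    by rewrite lt_sorted_uniq_le uE sorted_map.
  by rewrite sorted_map.
have /choice[v vP] (a : L) : exists i, d a i = [seq x <- E | val x < val a].
  by apply: dP; apply/allP => x; rewrite mem_filter => /andP[].
(* At this i the tree has depth [size E] and the guess is right for every a in s. *)
have [j jP] := uP s v; have [i hi] := hs (size E, j).
exists i => a b sa sb ab.
have preE c : c \in s -> pre c i = [seq x <- E | val x < val c].
  by move=> sc; rewrite /pre hi /= jP.
have split_b := filter_lt_split E_sorted (etrans (Es a) sa) ab.
(* The list of b omits b itself, so words of length [size E] have room for the letter b after it. *)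
have size_b : (size [seq x <- E | (val x < val b)%O] < size E)%N.
  rewrite size_filter -(count_predC (fun x : L => val x < val b) E).
  rewrite -[X in (X < _)%N]addn0 ltn_add2l -has_count; apply/hasP.
  by exists b; rewrite ?Es //= ltxx.
rewrite /I !wo_seg_ltE !preE // hi /= split_b map_cat /=.
set p := map l _; set r := map l _.
have pr : (size (p ++ l a :: r) < size E)%N.
  by move: size_b; rewrite split_b !size_cat /= !size_map.
have [h1 h2] := node_nested zmin (l b) pr.
by split=> //; exact: node_lt.
Qed.

(** * The ultrafilter and the failure of the three conditions *)

Lemma card_set_embeds (T U : Type) (u0 : U) (S : set T) :
  S #<= [set: U] -> exists f : T -> U, {in S &, injective f}.
Proof.
move=> /card_leP[f].
have /choice[h hP] (x : T) : exists y : U, forall Sx : x \in S,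
    y = val (f (exist _ x Sx)).
  have [Sx|nSx] := pselect (x \in S); last by exists u0.
  by exists (val (f (exist _ x Sx))) => Sx'; rewrite (bool_irrelevance Sx Sx').
exists h => x y Sx Sy; rewrite (hP _ Sx) (hP _ Sy) => /val_inj/inj e.
by have /(congr1 val) := e (mem_set I) (mem_set I).
Qed.

Lemma set_embeds_card (T U : Type) (S : set T) :
  (exists f : T -> U, {in S &, injective f}) -> S #<= [set: U].
Proof.
move=> [f fI]; have [g] : $|{injfun S >-> [set: U]}|.
  by apply/injfunPex; exists f.
exact: inj_card_le.
Qed.

Theorem theorem2p2 (k : On) (k_card : is_cardinal k)
    (k_inf : infinite_set [set: seg k]) :
  exists (U : set_system (seg k)) (fs : seg (succ_card k) -> seg k -> On),
    let I := dual U in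
    UltraFilter U /\
    increasing_mod I fs /\
    ~ (exists f : seg k -> On,
         exact_upper_bound I fs f /\ forall i, k < cof (f i)) /\
    ~ (exists (S : seg k -> set On) (W : set_system (seg k)),
         (forall i, S i #<= [set: seg k]) /\
         UltraFilter W /\
         dual I `<=` W /\
         forall a, exists (h : seg k -> On) (b : seg (succ_card k)),
           (forall i, S i (h i)) /\
           lt_mod (dual W) (fs a) h /\ lt_mod (dual W) h (fs b)) /\
    ~ (exists g : seg k -> On,
         ~ stabilizes_mod I (fun a => [set i | fs a i > g i])).
Proof.
have [f [g [rk [chain few]]]] := nested_intervals k_inf.
set L := seg (succ_card k) in f g rk chain few *.
have sqk := embeds_square k_inf; have /infinite_embeds natk := k_inf.
have [x0 _] := infinite_setN0 k_inf.
pose good (s : seq L) i := {in s &, forall a b, val a < val b ->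
  [/\ f a i < f b i, f b i < g b i & g b i < g a i]}.
(* The sets [good s] generate a filter: [chain] makes them nonempty, and concatenating lists handles
   intersections. *)
pose F := [set X : set (seg k) | exists s, good s `<=` X].
have FF : ProperFilter F.
  split; first by move=> [s]; have [i gi] := chain s; move=> /(_ i gi).
  split=> [|X Y [s sX] [t tY]|X Y XY [s sX]].
  - by exists [::].
  - exists (s ++ t) => i gi; split; [apply: sX|apply: tY] => a b sa sb;
      by apply: gi; rewrite mem_cat ?sa ?sb ?orbT.
  - by exists s; exact: subset_trans sX XY.
have [U [UU FU]] := ultraFilterLemma FF.
have Unest (a b : L) : val a < val b ->
    U [set i | [/\ f a i < f b i, f b i < g b i & g b i < g a i]].
  by move=> ab; apply: FU; exists [:: a; b] => i; apply; rewrite ?inE ?eqxx ?orbT.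
have Ufg (a b : L) : U [set i | f a i < g b i].
  wlog ab : a b / val a <= val b => [wl|].
    have [|ba] := leP (val a) (val b); first exact: wl.
    by apply: filterS (Unest _ _ ba) => i /= [_ h1 h2]; exact: lt_trans h2.
  (* For c above b, f a < f c < g c < g b modulo U. *)
  have [c bc] := succ_card_unbounded b k_inf.
  have := Unest _ _ bc; apply: filterS2 (Unest _ _ (le_lt_trans ab bc)) => i /=.
  by move=> [h1 _ _] [_ h2 h3]; exact: lt_trans (lt_trans h1 h2) h3.
(* Otherwise the index i, the code of o in S i and the rank would determine a, by [few]. *)
have no_selection (S : seg k -> set On) : (forall i, S i #<= [set: seg k]) ->
    ~ forall a, exists i o, S i o /\ f a i < o < g a i.
  move=> Sk sel; apply: (@succ_card_not_embeds k).
  have /choice[phi phiI] i := card_set_embeds x0 (Sk i).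
  have /choice[t tP] (a : L) : exists p : seg k * On,
      S p.1 p.2 /\ f a p.1 < p.2 < g a p.1.
    by have [i [o ?]] := sel a; exists (i, o).
  apply: (@embeds_trans _ (seg k * seg k * nat)); last first.
    by apply: embeds_prodl => //; apply: embeds_prodl => //; exists id.
  exists (fun a => ((t a).1, phi (t a).1 (t a).2, rk a (t a).1)) => a b.
  have [Sa fa] := tP a; have [Sb fb] := tP b; move=> [e1 e2 e3].
  move: Sa fa e2 e3; rewrite e1 => Sa fa e2 e3.
  have e4 : (t a).2 = (t b).2 by apply: (phiI (t b).1) => //; exact: mem_set.
  by rewrite e4 in fa; exact: few fa fb e3.
exists U, f; split=> //; split; last split; last split.
- move=> a b ab; rewrite /lt_mod /dual /=.
  by apply: filterS (Unest _ _ ab) => i [/= h _ _]; apply/negP; rewrite -ltNge.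
- move=> [e [[ub ex] _]].
  have fe a : U [set i | f a i < e i].
    have [b ab] := succ_card_unbounded a k_inf.
    have := ub b; rewrite /le_mod /dual /=.
    apply: filterS2 (Unest _ _ ab) => i [/= h _ _] /negP; rewrite -leNgt.
    exact: lt_le_trans.
  (* If g a <= e on a set in U, then g b < e modulo U for b above a, and exactness yields c with g b
     < f c, against [Ufg]. *)
  have eg a : U [set i | e i < g a i].
    have [//|nU] := in_ultra_setVsetC [set i | e i < g a i] UU.
    have [b ab] := succ_card_unbounded a k_inf.
    have [|c] := ex (g b).
      rewrite /lt_mod /dual /=.
      apply: filterS2 (Unest _ _ ab) nU => i [/= _ _ h] /negP.
      by rewrite -leNgt => le; apply/negP; rewrite -ltNge; exact: lt_le_trans le.
    rewrite /lt_mod /dual /= => h.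
    by have [i [/= nh /ltW /nh]] := filter_ex (filterI h (Ufg c b)).
  apply: (no_selection (fun i => [set e i])).
    move=> i; apply: set_embeds_card.
    by exists (fun=> x0) => x y; rewrite !inE => -> ->.
  move=> a; have [i [/= h1 h2]] := filter_ex (filterI (fe a) (eg a)).
  by exists i, (e i); rewrite h1 h2.
- move=> [S [W [Sk [WU [UW sel]]]]]; apply: (no_selection S Sk) => a.
  have [h [b [Sh [fh hf]]]] := sel a.
  (* The dual of the dual is U up to a double complement. *)
  have WU' X : U X -> W X.
    by move=> UX; apply: UW; apply: filterS UX => i Xi; apply.
  have W_lt (e e' : seg k -> On) :
      lt_mod (dual W) e e' -> W [set i | e i < e' i].
    by rewrite /lt_mod /dual /=; apply: filterS => i /negP; rewrite -ltNge.
  (* Since h < f b and f b < g a modulo W, some h i lies in the interval of a. *)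
  have [i [[/= h1 h2] h3]] :=
    filter_ex (filterI (filterI (W_lt _ _ fh) (W_lt _ _ hf)) (WU' _ (Ufg b a))).
  by exists i, (h i); rewrite h1 (lt_trans h2 h3).
- move=> [e]; apply; rewrite /stabilizes_mod /eq_mod /subset_mod.
  have dualS (X Y : set (seg k)) : U Y -> (forall i, Y i -> ~ X i) -> dual U X.
    by move=> UY YX; apply: filterS UY.
  (* The sets grow modulo U: once one of them is in U, so are all later ones; otherwise all their
     complements are in U. *)
  have [[a Ua]|nU] := pselect (exists a, U [set i | e i < f a i]).
    exists a => b ab.
    have Ub : U [set i | e i < f b i].
      move: ab; rewrite le_eqVlt => /orP[/eqP/val_inj <-//|ab].
      by apply: filterS2 Ua (Unest _ _ ab) => i /= h [h' _ _]; exact: lt_trans h'.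
    by split; [apply: (dualS _ _ Ua)|apply: (dualS _ _ Ub)] => i h [].
  have nU' (a : L) : U (~` [set i | e i < f a i])%classic.
    have [h|//] := in_ultra_setVsetC [set i | e i < f a i] UU.
    by case: nU; exists a.
  (* Any index would do here; k is one below [succ_card k]. *)
  have [[_ kS] _] := succ_cardP k; exists (exist _ k kS) => b _.
  by split; [apply: (dualS _ _ (nU' b))|apply: (dualS _ _ (nU' _))] =>
    i nh [/nh].
Qed.
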